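(* Let $(A^\bullet, F^\bullet, \widehat F^\bullet, W^\bullet)$ be a $\mathbb{C}$-Hodge complex (of complex vector spaces). Then: (a) The spectral sequence of the filtered complex $(A^\bullet, W^\bullet)$, with $E_1^{pq}=H^{p+q}(Gr_W^pA^\bullet)\Rightarrow H^{p+q}(A^\bullet)$, degenerates at $E_2$. (b) For every $i$, $H^i(A^\bullet)$ is a $\mathbb{C}$-Hodge structure with respect to the three (decreasing) filtrations $$F^pH^i(A^\bullet)=\mathrm{image}[H^i(F^pA^\bullet)\to H^i(A^\bullet)],$$ $$\widehat F^pH^i(A^\bullet)=\mathrm{image}[H^i(\widehat F^pA^\bullet)\to H^i(A^\bullet)],$$ $$W^kH^i(A^\bullet)=\mathrm{image}[H^i(W^{k+i}A^\bullet)\to H^i(A^\bullet)].$$ (c) The spectral sequences of the filtered complexes $(A^\bullet,F^\bullet)$ and $(A^\bullet,\widehat F^\bullet)$ degenerate at $E_1$.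
   Context: Filtrations indexed by superscripts are decreasing, those indexed by subscripts are increasing; one passes between them by $W^{-n}=W_n$. A $\mathbb{C}$-Hodge structure (also called $\mathbb{C}$-mixed Hodge structure) is a finite dimensional complex vector space $H$ with three finite filtrations $(F^\bullet,\widehat F^\bullet,W_\bullet)$ ($F,\widehat F$ decreasing, $W$ increasing, equivalently $W^{-n}=W_n$ decreasing) which are opposed: writing $Gr^W_nH=W_n/W_{n-1}$ with the filtrations induced by $F$ and $\widehat F$, one has $Gr^W_nH=F^pGr^W_nH\oplus\widehat F^qGr^W_nH$ whenever $p+q=n+1$. It is pure of weight $n$ if $Gr^W_nH=H$; a pure structure is given just by $F$ and $\widehat F$. A filtration on a complex $A^\bullet$ is a sequence of filtrations $F^\bullet A^n\subset A^n$ compatible with the differentials; it is biregular if for each $n$ there are $a,b$ with $F^aA^n=A^n$ and $F^bA^n=0$. A $\mathbb{C}$-Hodge complex is a bounded below complex $A^\bullet$ of $\mathbb{C}$-vector spaces with three biregular decreasing filtrations $F^\bullet,\widehat F^\bullet,W^\bullet$ such that: HC1. $A^\bullet$ has finite dimensional cohomology. HC2. For each $p$, the filtrations on $Gr^p_WA$ induced by $F$ and by $\widehat F$ are strictly preserved by the differentials (i.e. $d(F^k)=\mathrm{image}(d)\cap F^k$ for all $k$, and likewise for $\widehat F$). HC3. For all $i,p$, $H^i(Gr^p_WA)$ with the filtrations $\mathrm{image}[H^i(F^\bullet Gr^p_WA)\to H^i(Gr^p_WA)]$ and $\mathrm{image}[H^i(\widehat F^\bullet Gr^p_WA)\to H^i(Gr^p_WA)]$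 is a pure $\mathbb{C}$-Hodge structure of weight $i-p$. A spectral sequence degenerates at $E_r$ if all differentials $d_s$ with $s\ge r$ vanish. *)

(* Defs.v *)
From HB Require Import structures.
From mathcomp Require Import all_boot all_order all_algebra.
From mathcomp Require Import generic_quotient ring_quotient.
From mathcomp Require Import boolp.

Set Implicit Arguments.
Unset Strict Implicit.
Unset Printing Implicit Defensive.

Import GRing.Theory.
Local Open Scope ring_scope.
Local Open Scope quotient_scope.

(* Subspaces are the library's [submodClosed V].  Those below are obtained from
   Prop-valued predicates, made boolean classically by [asbool]. *)
Section Subspaces.
Variable K : fieldType.

Section Mksub.
Variables (V : lmodType K) (P : V -> Prop).
Hypotheses (P0 : P 0) (PS : forall a x y, P x -> P y -> P (a *: x + y)).

Definition mksub_pred (_ : P 0)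
    (_ : forall a x y, P x -> P y -> P (a *: x + y)) : {pred V} :=
  fun x => `[< P x >].

Fact mksub_closed : submod_closed (mksub_pred P0 PS).
Proof.
split; first exact/asboolP.
by move=> a x y /asboolP Px /asboolP Py; apply/asboolP/PS.
Qed.
HB.instance Definition _ := GRing.isSubmodClosed.Build K V (mksub_pred P0 PS)
  (GRing.submod_closed_semi mksub_closed).

Definition mksub : submodClosed V := mksub_pred P0 PS.

Lemma mksubP x : reflect (P x) (x \in mksub).
Proof. exact: (asboolP (P x)). Qed.
End Mksub.

Lemma submodN (V : lmodType K) (S : submodClosed V) x :
  (- x \in S) = (x \in S).
Proof.
have H y : y \in S -> - y \in S by move=> yS; rewrite -scaleN1r rpredZ.
by apply/idP/idP => [/H|/H //]; rewrite opprK.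
Qed.

Definition topS (V : lmodType K) : submodClosed V :=
  @mksub V (fun=> True) I (fun _ _ _ _ _ => I).

Definition capS (V : lmodType K) (S T : submodClosed V) : submodClosed V.
Proof.
apply: (@mksub V (fun x => x \in S /\ x \in T)); first by rewrite !rpred0.
by move=> a x y [xS xT] [yS yT]; rewrite !rpredD ?rpredZ.
Defined.

Definition addS (V : lmodType K) (S T : submodClosed V) : submodClosed V.
Proof.
apply: (@mksub V (fun x => exists s t, [/\ s \in S, t \in T & x = s + t])).
  by exists 0, 0; rewrite !rpred0 addr0.
move=> a _ _ [s [t [sS tT ->]]] [s' [t' [sS' tT' ->]]].
exists (a *: s + s'), (a *: t + t').
by rewrite !rpredD ?rpredZ // scalerDr addrACA.
Defined.

Definition imgS (V W : lmodType K) (f : {linear V -> W}) (S : submodClosed V) :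
  submodClosed W.
Proof.
apply: (@mksub W (fun y => exists2 x, x \in S & f x = y)).
  by exists 0; rewrite ?rpred0 ?linear0.
move=> a _ _ [x xS <-] [y yS <-].
by exists (a *: x + y); rewrite ?rpredD ?rpredZ ?linearP.
Defined.

Definition preimS (V W : lmodType K) (f : {linear V -> W})
  (T : submodClosed W) : submodClosed V.
Proof.
apply: (@mksub V (fun x => f x \in T)); first by rewrite linear0 rpred0.
by move=> a x y xT yT; rewrite linearP rpredD ?rpredZ.
Defined.

Definition kerS (V W : lmodType K) (f : {linear V -> W}) : submodClosed V.
Proof.
apply: (@mksub V (fun x => f x = 0)); first exact: linear0.
by move=> a x y fx fy; rewrite linearP fx fy scaler0 addr0.
Defined.

Lemma in_topS (V : lmodType K) (x : V) : x \in topS V.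
Proof. exact/mksubP. Qed.

Lemma capSP (V : lmodType K) (S T : submodClosed V) x :
  reflect (x \in S /\ x \in T) (x \in capS S T).
Proof. exact: mksubP. Qed.

Lemma addSP (V : lmodType K) (S T : submodClosed V) x :
  reflect (exists s t, [/\ s \in S, t \in T & x = s + t]) (x \in addS S T).
Proof. exact: mksubP. Qed.

Lemma imgSP (V W : lmodType K) (f : {linear V -> W}) (S : submodClosed V) y :
  reflect (exists2 x, x \in S & f x = y) (y \in imgS f S).
Proof. exact: mksubP. Qed.

Lemma preimSP (V W : lmodType K) (f : {linear V -> W}) (T : submodClosed W) x :
  reflect (f x \in T) (x \in preimS f T).
Proof. exact: mksubP. Qed.

Lemma kerSP (V W : lmodType K) (f : {linear V -> W}) x :
  reflect (f x = 0) (x \in kerS f).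
Proof. exact: mksubP. Qed.

Definition direct_sum (V : lmodType K) (S T : submodClosed V) : Prop :=
  (forall x, x \in addS S T) /\ (forall x, x \in S -> x \in T -> x = 0).

Definition finite_dimensional (V : lmodType K) : Prop :=
  exists n, inhabited (Vector.axiom n V).

End Subspaces.

Definition submod (K : fieldType) (V : lmodType K) (S : submodClosed V) : Type :=
  {x : V | x \in S}.

Section Submod.
Variables (K : fieldType) (V : lmodType K) (S : submodClosed V).
HB.instance Definition _ := SubChoice.on (submod S).
HB.instance Definition _ := GRing.SubChoice_isSubLmodule.Build K V (mem S)
  (submod S) (GRing.submod_closed_semi (submodClosedP S)).

Definition incl (x : submod S) : V := val x.
Lemma incl_is_linear : linear incl.
Proof. by []. Qed.
HB.instance Definition _ :=
  GRing.isLinear.Build K (submod S) V _ incl incl_is_linear.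
End Submod.

Definition zmod_pred (K : fieldType) (V : lmodType K) (S : submodClosed V) :
  {pred V} := fun x => x \in S.

Fact zmod_pred_closed (K : fieldType) (V : lmodType K) (S : submodClosed V) :
  zmod_closed (zmod_pred S).
Proof. exact: GRing.submod_closedB (submodClosedP S). Qed.
HB.instance Definition _ (K : fieldType) (V : lmodType K) (S : submodClosed V) :=
  GRing.isZmodClosed.Build V (zmod_pred S) (zmod_pred_closed S).

(* The library's quotient of the underlying group, with its vector space
   structure. *)
Definition quotmod (K : fieldType) (V : lmodType K) (S : submodClosed V) : Type :=
  Quotient.quot (zmod_pred S).

Section Quotmod.
Variables (K : fieldType) (V : lmodType K) (S : submodClosed V).
HB.instance Definition _ := GRing.Zmodule.on (quotmod S).

Definition proj (x : V) : quotmod S := \pi_(Quotient.quot (zmod_pred S)) x.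

Lemma projP x y : reflect (proj x = proj y) (x - y \in S).
Proof.
have -> : (x - y \in S) = (x - y \in zmod_pred S) by [].
by rewrite Quotient.idealrBE; apply: eqP.
Qed.

Lemma proj_surj (q : quotmod S) : exists x, proj x = q.
Proof. by exists (repr q); rewrite /proj reprK. Qed.

Lemma projD : {morph proj : x y / x + y}.
Proof. by move=> x y; rewrite /proj !piE. Qed.

Definition quot_scale (a : K) (q : quotmod S) : quotmod S :=
  proj (a *: repr (q : Quotient.quot (zmod_pred S))).

Lemma quot_scaleE a x : quot_scale a (proj x) = proj (a *: x).
Proof.
apply/projP; rewrite -scalerBr rpredZ //.
by apply/projP; rewrite /proj reprK.
Qed.

Fact quot_scalerA a b q : quot_scale a (quot_scale b q) = quot_scale (a * b) q.
Proof. by have [x <-] := proj_surj q; rewrite !quot_scaleE scalerA. Qed.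
Fact quot_scale1r : left_id 1 quot_scale.
Proof. by move=> q; have [x <-] := proj_surj q; rewrite quot_scaleE scale1r. Qed.
Fact quot_scalerDr : right_distributive quot_scale +%R.
Proof.
move=> a q q'; have [x <-] := proj_surj q; have [y <-] := proj_surj q'.
by rewrite -projD !quot_scaleE -projD scalerDr.
Qed.
Fact quot_scalerDl q : {morph quot_scale^~ q : a b / a + b}.
Proof.
by move=> a b; have [x <-] := proj_surj q; rewrite !quot_scaleE -projD scalerDl.
Qed.
HB.instance Definition _ := GRing.Zmodule_isLmodule.Build K (quotmod S)
  quot_scalerA quot_scale1r quot_scalerDr quot_scalerDl.

Lemma proj_is_linear : linear proj.
Proof. by move=> a x y; rewrite projD -quot_scaleE. Qed.
HB.instance Definition _ :=
  GRing.isLinear.Build K V (quotmod S) _ proj proj_is_linear.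
End Quotmod.

(* The subquotient S / (S :&: T) of V, for arbitrary subspaces S and T. *)
Section Subquotient.
Variable K : fieldType.

Definition subquo (V : lmodType K) (S T : submodClosed V) : lmodType K :=
  quotmod (preimS (@incl K V S) T).

Definition subquo_class (V : lmodType K) (S T : submodClosed V) :
  {linear submod S -> subquo S T} := @proj K _ (preimS (@incl K V S) T).

Lemma subquo_surj (V : lmodType K) (S T : submodClosed V) (q : subquo S T) :
  exists x, subquo_class S T x = q.
Proof. exact: proj_surj. Qed.

Lemma subquo_classP (V : lmodType K) (S T : submodClosed V) (x y : submod S) :
  reflect (subquo_class S T x = subquo_class S T y) (incl x - incl y \in T).
Proof.
apply: (iffP idP) => [xyT|/projP/preimSP]; last by rewrite linearB.
by apply/projP/preimSP; rewrite linearB.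
Qed.

Lemma subquo_class0P (V : lmodType K) (S T : submodClosed V) (x : submod S) :
  reflect (subquo_class S T x = 0) (incl x \in T).
Proof.
rewrite -[incl x]subr0 -(linear0 (@incl K V S)) -(linear0 (subquo_class S T)).
exact: subquo_classP.
Qed.

(* The subspace induced by U: the image of U :&: S. *)
Definition indS (V : lmodType K) (S T U : submodClosed V) :
  submodClosed (subquo S T) :=
  imgS (subquo_class S T) (preimS (@incl K V S) U).

Section Map.
Variables (V W : lmodType K) (f : {linear V -> W}).
Variables (S T : submodClosed V) (S' T' : submodClosed W).
Hypothesis fS : forall x, x \in S -> f x \in S'.
Hypothesis fT : forall x, x \in S -> x \in T -> f x \in T'.

Definition submod_map (x : submod S) : submod S' :=
  exist _ (f (incl x)) (fS (valP x)).

Lemma submod_map_is_linear : linear submod_map.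
Proof. by move=> a x y; apply: val_inj; rewrite /= !linearP. Qed.
HB.instance Definition _ := GRing.isLinear.Build K (submod S) (submod S') _
  submod_map submod_map_is_linear.

Definition subquo_fun (q : subquo S T) : subquo S' T' :=
  subquo_class S' T' (submod_map (repr (q : Quotient.quot _))).

Lemma subquo_funE x :
  subquo_fun (subquo_class S T x) = subquo_class S' T' (submod_map x).
Proof.
apply/projP/preimSP; rewrite -linearB /=.
suff /preimSP/fT : repr (subquo_class S T x : Quotient.quot _) - x
  \in preimS (@incl K V S) T by apply; apply: valP.
by apply/projP; rewrite /proj reprK.
Qed.

Lemma subquo_fun_is_linear : linear subquo_fun.
Proof.
move=> a q q'; have [x <-] := subquo_surj q; have [y <-] := subquo_surj q'.
by rewrite -linearP !subquo_funE !linearP.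
Qed.
Definition subquo_map : {linear subquo S T -> subquo S' T'} :=
  HB.pack subquo_fun (GRing.isLinear.Build K (subquo S T) (subquo S' T') _
    subquo_fun subquo_fun_is_linear).

Lemma subquo_mapE x :
  subquo_map (subquo_class S T x) = subquo_class S' T' (submod_map x).
Proof. exact: subquo_funE. Qed.
End Map.

End Subquotient.

(* Filtrations of vector spaces are indexed by [int], and decreasing unless
   said otherwise. *)
Section HodgeStructure.
Variables (K : fieldType) (H : lmodType K).

Definition finite_filtration (F : int -> submodClosed H) : Prop :=
  [/\ forall p x, x \in F (p + 1) -> x \in F p,
      exists a, forall x, x \in F a
    & exists b, forall x, x \in F b -> x = 0].

(* Here W is increasing. *)
Record hodge_structure (F G W : int -> submodClosed H) : Prop := {
  hodge_fin_dim : finite_dimensional H;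
  hodge_F_finite : finite_filtration F;
  hodge_G_finite : finite_filtration G;
  hodge_W_finite : finite_filtration (fun n => W (- n));
  hodge_opposed : forall n p q : int, p + q = n + 1 ->
    direct_sum (indS (W n) (W (n - 1)) (F p)) (indS (W n) (W (n - 1)) (G q))
}.

Definition pure_hodge_structure (n : int) (F G : int -> submodClosed H) : Prop :=
  exists W, [/\ hodge_structure F G W, forall x, x \in W n
              & forall x, x \in W (n - 1) -> x = 0].

End HodgeStructure.

(* The differential is given between any two degrees, and vanishes unless they
   are consecutive; this avoids transports along equalities of degrees. *)
Record cochain_complex (K : fieldType) := Complex {
  obj :> int -> lmodType K;
  diff : forall i j, {linear obj i -> obj j};
  diff_shape : forall i j x, j <> i + 1 -> diff i j x = 0;
  diff_diff : forall i j k x, diff j k (diff i j x) = 0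
}.

Section Complexes.
Variable K : fieldType.

Definition bounded_below (A : cochain_complex K) : Prop :=
  exists N : int, forall n (x : A n), n < N -> x = 0.

Definition coh (A : cochain_complex K) (i : int) : lmodType K :=
  subquo (kerS (diff A i (i + 1))) (imgS (diff A (i - 1) i) (topS _)).

Record morphism (A B : cochain_complex K) := Morphism {
  mor :> forall i, {linear A i -> B i};
  mor_diff : forall i j x, mor j (diff A i j x) = diff B i j (mor i x)
}.

Section CohMap.
Variables (A B : cochain_complex K) (f : morphism A B) (i : int).

Fact coh_map_ker x :
  x \in kerS (diff A i (i + 1)) -> f i x \in kerS (diff B i (i + 1)).
Proof. by move=> /kerSP dx; apply/kerSP; rewrite -mor_diff dx linear0. Qed.

Fact coh_map_img x : x \in kerS (diff A i (i + 1)) ->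
  x \in imgS (diff A (i - 1) i) (topS _) ->
  f i x \in imgS (diff B (i - 1) i) (topS _).
Proof.
move=> _ /imgSP [y _ <-]; apply/imgSP.
by exists (f (i - 1) y); [exact: in_topS | rewrite mor_diff].
Qed.

Definition coh_map : {linear coh A i -> coh B i} :=
  @subquo_map K _ _ (f i) _ _ _ _ coh_map_ker coh_map_img.
End CohMap.

Record filtration (A : cochain_complex K) := Filtration {
  fil :> int -> forall i, submodClosed (A i);
  fil_decr : forall p i x, x \in fil (p + 1) i -> x \in fil p i;
  fil_diff : forall p i j x, x \in fil p i -> diff A i j x \in fil p j
}.

Definition biregular (A : cochain_complex K) (F : filtration A) : Prop :=
  forall n, exists a b : int,
    (forall x, x \in F a n) /\ (forall x, x \in F b n -> x = 0).

Section Filtered.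
Variables (A : cochain_complex K) (F : filtration A) (p : int).

Definition fil_obj (i : int) : lmodType K := submod (F p i).
Definition fil_d i j : {linear fil_obj i -> fil_obj j} :=
  submod_map (@fil_diff A F p i j).
Fact fil_shape i j x : j <> i + 1 -> fil_d i j x = 0.
Proof. by move=> ij; apply: val_inj; rewrite /= diff_shape. Qed.
Fact fil_dd i j k x : fil_d j k (fil_d i j x) = 0.
Proof. by apply: val_inj; rewrite /= diff_diff. Qed.
Definition fil_complex : cochain_complex K := Complex fil_shape fil_dd.

Definition fil_incl : morphism fil_complex A :=
  @Morphism fil_complex A (fun i => @incl K _ (F p i)) (fun _ _ _ => erefl).

Definition gr_obj (i : int) : lmodType K := subquo (F p i) (F (p + 1) i).
Definition gr_d i j : {linear gr_obj i -> gr_obj j} :=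
  @subquo_map K _ _ (diff A i j) _ _ _ _ (@fil_diff A F p i j)
    (fun x _ => @fil_diff A F (p + 1) i j x).
Fact gr_shape i j x : j <> i + 1 -> gr_d i j x = 0.
Proof.
move=> ij; have [y <-] := subquo_surj x; rewrite /gr_d subquo_mapE.
rewrite -[RHS](linear0 (subquo_class _ _)); congr (subquo_class _ _ _).
exact: fil_shape.
Qed.
Fact gr_dd i j k x : gr_d j k (gr_d i j x) = 0.
Proof.
have [y <-] := subquo_surj x; rewrite /gr_d !subquo_mapE.
rewrite -[RHS](linear0 (subquo_class _ _)); congr (subquo_class _ _ _).
exact: fil_dd.
Qed.
Definition gr : cochain_complex K := Complex gr_shape gr_dd.

Section Induced.
Variable G : filtration A.
Definition gr_fil_obj (k i : int) : submodClosed (gr i) :=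
  indS (F p i) (F (p + 1) i) (G k i).
Fact gr_fil_decr k i x : x \in gr_fil_obj (k + 1) i -> x \in gr_fil_obj k i.
Proof.
move=> /imgSP [y /preimSP yG <-]; apply/imgSP; exists y => //.
exact/preimSP/fil_decr.
Qed.
Fact gr_fil_diff k i j x :
  x \in gr_fil_obj k i -> diff gr i j x \in gr_fil_obj k j.
Proof.
move=> /imgSP [y /preimSP yG <-]; apply/imgSP.
exists (fil_d i j y); last by rewrite [RHS]subquo_mapE.
exact/preimSP/fil_diff.
Qed.
Definition gr_fil : filtration gr := Filtration gr_fil_decr gr_fil_diff.
End Induced.

End Filtered.

Definition coh_fil (A : cochain_complex K) (F : filtration A) (i p : int) :
  submodClosed (coh A i) :=
  imgS (coh_map (fil_incl F p) i) (topS _).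

(* W^k H^i is the image of H^i(W^{k+i} A). *)
Definition coh_weight_fil (A : cochain_complex K) (W : filtration A)
  (i k : int) : submodClosed (coh A i) := coh_fil W i (k + i).

Definition strict (A : cochain_complex K) (F : filtration A) : Prop :=
  forall k i, imgS (diff A i (i + 1)) (F k i) =i
    capS (imgS (diff A i (i + 1)) (topS _)) (F k (i + 1)).

(* E_r^{p,q} = Z_r^{p,q} / (Z_{r-1}^{p+1,q-1} + d Z_{r-1}^{p-r+1,q+r-2}), where
   Z_r^{p,q} consists of the x in F^p A^{p+q} with dx in F^{p+r}.  Below n is
   the total degree p + q; the formula also makes sense for r = 0, where it
   gives the graded pieces of F. *)
Section SpectralSequence.
Variables (A : cochain_complex K) (F : filtration A).

Definition ss_Z (r p n : int) : submodClosed (A n) :=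
  capS (F p n) (preimS (diff A n (n + 1)) (F (p + r) (n + 1))).

Definition ss_B (r p n : int) : submodClosed (A n) :=
  addS (ss_Z (r - 1) (p + 1) n)
    (imgS (diff A (n - 1) n) (ss_Z (r - 1) (p - r + 1) (n - 1))).

Definition ss_E (r p q : int) : lmodType K :=
  subquo (ss_Z r p (p + q)) (ss_B r p (p + q)).

(* E_1^{p,q} is H^{p+q} of the p-th graded piece: the cycles and the boundaries
   correspond under the projection of F^p to it. *)
Lemma ss_Z1E p n (x : submod (F p n)) :
  (incl x \in ss_Z 1 p n) =
  (subquo_class (F p n) (F (p + 1) n) x \in kerS (diff (gr F p) n (n + 1))).
Proof.
apply/capSP/kerSP => [[_ /preimSP dx]|].
  by rewrite [LHS]subquo_mapE; apply/subquo_class0P.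
rewrite [LHS]subquo_mapE => /subquo_class0P dx.
by split; [exact: valP | apply/preimSP].
Qed.

Lemma ss_B1E p n (x : submod (F p n)) :
  (incl x \in ss_B 1 p n) =
  (subquo_class (F p n) (F (p + 1) n) x
     \in imgS (diff (gr F p) (n - 1) n) (topS _)).
Proof.
apply/addSP/imgSP => [[s [_ [/capSP [sF _] /imgSP [t /capSP [tF _] <-] e]]]|].
  rewrite subrK in tF.
  exists (subquo_class (F p _) (F (p + 1) _) (exist _ t tF)).
    exact: in_topS.
  rewrite [LHS]subquo_mapE; apply/subquo_classP => /=.
  rewrite e; set y := incl _; have -> : y = diff A (n - 1) n t by [].
  by rewrite opprD addrCA subrr addr0 submodN.
move=> [y _]; have [z <-] := subquo_surj y; rewrite [LHS]subquo_mapE.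
move=> /subquo_classP; set dz := incl _ => zx0.
have zx : diff A (n - 1) n (incl z) - incl x \in F (p + 1) n by exact: zx0.
exists (incl x - diff A (n - 1) n (incl z)), (diff A (n - 1) n (incl z)).
split; last by rewrite subrK.
- apply/capSP; split; first by rewrite -opprB submodN.
  by apply/preimSP/fil_diff; rewrite subrr addr0 -opprB submodN.
- apply/imgSP; exists (incl z) => //; apply/capSP; rewrite subrK.
  split; first exact: valP.
  by apply/preimSP/fil_diff; rewrite subrr addr0; apply: valP.
Qed.

Fact ss_d_Z r p n m x : x \in ss_Z r p n -> diff A n m x \in ss_Z r (p + r) m.
Proof.
move=> /capSP [_ /preimSP dx]; apply/capSP; split; last first.
  by apply/preimSP; rewrite diff_diff rpred0.
have [->//|/eqP mn] := eqVneq m (n + 1).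
by rewrite diff_shape // rpred0.
Qed.

Fact ss_d_B r p n m x : x \in ss_Z r p n -> x \in ss_B r p n ->
  diff A n m x \in ss_B r (p + r) m.
Proof.
move=> _ /addSP [s [_ [sZ /imgSP [t _ <-] ->]]].
rewrite linearD diff_diff addr0; apply/addSP.
exists 0, (diff A n m s); split; [exact: rpred0 | | by rewrite add0r].
have [->|/eqP mn] := eqVneq m (n + 1); last first.
  by rewrite diff_shape //; exact: rpred0.
apply/imgSP; have -> : p + r - r + 1 = p + 1 by rewrite addrK.
suff H k : k = n -> exists2 y, y \in ss_Z (r - 1) (p + 1) k &
    diff A k (n + 1) y = diff A n (n + 1) s by apply: H; rewrite addrK.
by move=> ->; exists s.
Qed.

Definition ss_d (r p q : int) :
  {linear ss_E r p q -> ss_E r (p + r) (q - r + 1)} :=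
  @subquo_map K _ _ (diff A (p + q) (p + r + (q - r + 1))) _ _ _ _
    (@ss_d_Z r p _ _) (@ss_d_B r p _ _).

Definition degenerates_at (r : nat) : Prop :=
  forall s : nat, (r <= s)%N -> forall (p q : int) (x : ss_E s%:Z p q),
    ss_d s%:Z p q x = 0.

End SpectralSequence.

(* F, G, W stand for F, hat F, W; all three are decreasing. *)
Record hodge_complex (A : cochain_complex K) (F G W : filtration A) : Prop := {
  hc_bounded_below : bounded_below A;
  hc_F_biregular : biregular F;
  hc_G_biregular : biregular G;
  hc_W_biregular : biregular W;
  hc1 : forall i, finite_dimensional (coh A i);
  hc2_F : forall p, strict (gr_fil W p F);
  hc2_G : forall p, strict (gr_fil W p G);
  hc3 : forall i p, pure_hodge_structure (i - p)
    (coh_fil (gr_fil W p F) i) (coh_fil (gr_fil W p G) i)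
}.

End Complexes.

(* Main.v *)
(* Everything is done on representatives in [A].  By HC2 and HC3 the terms [E_1]
   of the weight spectral sequence are pure Hodge structures whose [F]-steps are
   the [E_1] of the filtered subcomplexes [F^k A].  The differential [d_1]
   preserves the weight, so it is compatible with the splittings
   [E_1 = F^k + G^l], hence strict, and [E_2] has the same properties.  For
   [r >= 2], [d_r] lowers the weight by [r - 1]: by downward induction on [k] it
   kills [F^k E_r], since the complement of [F^(k+1)] in [F^k] lies in some
   [G^l] and is sent into the intersection of [F^k] and [G^l] in a lower weight,
   which is zero.  Thus [d_r = 0], on [A] and on all [F^k A].  A cycle can
   therefore be corrected successively, without leaving [F^k], along the finite
   filtration [W]; this gives the strictness of [d] for [F] and the opposedness
   on the cohomology. *)

Require Import Defs.
From mathcomp Require Import all_boot all_order all_algebra.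
From mathcomp Require Import reals complex.
From mathcomp Require Import zify.

Import GRing.Theory.
Local Open Scope ring_scope.

Set Implicit Arguments.
Unset Strict Implicit.
Unset Printing Implicit Defensive.

(** * Linear algebra of subquotients and opposed filtrations *)

Definition to_submod (K : fieldType) (V : lmodType K) (S : submodClosed V) x
  (xS : x \in S) : submod S := exist _ x xS.

Lemma direct_sumC (K : fieldType) (V : lmodType K) (S T : submodClosed V) :
  direct_sum S T -> direct_sum T S.
Proof.
move=> [ST0 ST1]; split=> [x|x xT xS]; last exact: ST1.
have /addSP [s [t [sS tT ->]]] := ST0 x.
by apply/addSP; exists t, s; rewrite addrC.
Qed.

Section LinearAlgebra.
Variables (K : fieldType) (H : lmodType K).
Implicit Types S T F G : submodClosed H.

Lemma submodB S x y : x \in S -> y \in S -> x - y \in S.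
Proof. by move=> xS yS; rewrite rpredD ?submodN. Qed.

Lemma subrBBK (x z f g y : H) : x - f - g - (z - f - g - y) = x - z + y.
Proof.
rewrite -!(addrA _ (- f)) -opprD; move: (f + g) => s.
by rewrite !opprB [y + _]addrC !addrA subrK.
Qed.

Lemma subrBBB (x x' f g w : H) :
  f - g - w = (x - x' - w) - (x - f) + (x' - g).
Proof.
rewrite opprB [RHS](AC (3*2*2) ((4*7*3)*((1*5)*(2*6)))).
by rewrite /= subrr addNr !addr0.
Qed.

Lemma inclD S (x y : submod S) : incl (x + y) = incl x + incl y.
Proof. by []. Qed.

Lemma subrBB (x f g y z : H) : x - (f - y) - (g - z) = (x - f - g) + (y + z).
Proof. by rewrite !opprB (AC (1*2*2) ((1*3*5)*(2*4))). Qed.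


Lemma indSP S T F (x : submod S) :
  reflect (exists2 f, f \in S & f \in F /\ incl x - f \in T)
          (subquo_class S T x \in indS S T F).
Proof.
apply: (iffP idP) => [/imgSP [f /preimSP fF /esym/subquo_classP fx]|].
  by exists (incl f) => //; apply: valP.
move=> [f fS [fF xf]]; apply/imgSP; exists (to_submod fS); first exact/preimSP.
exact/esym/subquo_classP.
Qed.

(** Removes the quotient from opposedness. The second condition compares two representatives [f] and
    [g] of one class, since a class in both induced subspaces need not have a common
    representative. *)
Lemma direct_sum_indSP S T F G :
  direct_sum (indS S T F) (indS S T G) <->
  (forall x, x \in S -> exists f g,
     [/\ f \in S /\ f \in F, g \in S /\ g \in G & x - f - g \in T]) /\
  (forall f g, f \in S /\ f \in F -> g \in S /\ g \in G -> f - g \in T ->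
     f \in T).
Proof.
split=> [[ST0 ST1]|[dec int]]; split.
- move=> x xS; have /addSP [s [t []]] := ST0 (subquo_class S T (to_submod xS)).
  move=> /imgSP [f /preimSP fF <-] /imgSP [g /preimSP gG <-].
  rewrite -linearD => /subquo_classP; rewrite inclD opprD addrA => xfg.
  by exists (incl f), (incl g); split=> //; split=> //; apply: valP.
- move=> f g [fS fF] [gS gG] fg.
  apply/(@subquo_class0P _ _ S T (to_submod fS))/ST1; apply/indSP.
    by exists f => //; rewrite subrr rpred0.
  by exists g.
- move=> c; have [x <-] := subquo_surj c.
  have [f [g [[fS fF] [gS gG] xfg]]] := dec _ (valP x).
  apply/addSP; exists (subquo_class S T (to_submod fS)).
  exists (subquo_class S T (to_submod gS)); split.
  + by apply/indSP; exists f; rewrite ?subrr ?rpred0.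
  + by apply/indSP; exists g; rewrite ?subrr ?rpred0.
  + by rewrite -linearD; apply/subquo_classP; rewrite inclD opprD addrA.
- move=> c; have [x <-] := subquo_surj c.
  move=> /indSP [f fS [fF xf]] /indSP [g gS [gG xg]].
  apply/subquo_class0P; rewrite -(subrK f (incl x)) rpredD //.
  apply: (int f g) => //.
  have -> : f - g = (incl x - g) - (incl x - f).
    by rewrite opprB [RHS]addrC addrA subrK.
  exact: submodB.
Qed.

(** Purity makes [W n] everything and [W (n - 1)] zero, so the opposed splitting of the graded piece
    is a splitting of [H] itself. *)
Lemma pure_direct_sum (n p q : int) (F G : int -> submodClosed H) :
  pure_hodge_structure n F G -> p + q = n + 1 -> direct_sum (F p) (G q).
Proof.
move=> [W [hW Wn Wn1]] pq.
have [dec int] := (direct_sum_indSP _ _ _ _).1 (hodge_opposed hW pq).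
split=> [x|x xF xG].
  have [f [g [[_ fF] [_ gG] xfg]]] := dec x (Wn x).
  apply/addSP; exists f, g; split=> //.
  by apply/eqP; rewrite -subr_eq0 opprD addrA; apply/eqP/Wn1.
by apply/Wn1/(int x x) => //; rewrite subrr rpred0.
Qed.

Lemma hodge_structureC (F G W : int -> submodClosed H) :
  hodge_structure F G W -> hodge_structure G F W.
Proof.
move=> [fH fF fG fW opp]; split=> // n p q pq.
by apply: direct_sumC; apply: opp; rewrite addrC.
Qed.

End LinearAlgebra.

(** * Filtered complexes handled on representatives *)

Section Complexes.
Variables (K : fieldType) (A : cochain_complex K).

Lemma coh_filP (F : filtration A) (i p : int)
    (x : submod (kerS (diff A i (i + 1)))) :
  reflect (exists z, [/\ z \in F p i, diff A i (i + 1) z = 0 &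
             incl x - z \in imgS (diff A (i - 1) i) (topS _)])
    (subquo_class _ (imgS (diff A (i - 1) i) (topS _)) x \in coh_fil F i p).
Proof.
apply: (iffP idP) => [/imgSP [c _]|[z [zF dz xz]]].
  have [z <-] := subquo_surj c; rewrite [LHS]subquo_mapE => /esym/subquo_classP.
  move=> xz; exists (incl (incl z)); split=> //; first exact: valP.
  by have /kerSP/(congr1 (@incl _ _ _)) := valP z.
have dz' : (exist _ z zF : submod (F p i)) \in
    kerS (diff (fil_complex F p) i (i + 1)).
  by apply/kerSP; apply: val_inj.
apply/imgSP; exists (subquo_class _ _ (to_submod dz')); first exact: in_topS.
by rewrite [LHS]subquo_mapE; apply/esym/subquo_classP.
Qed.

Lemma fil_le (F : filtration A) (p q i : int) x :
  p <= q -> x \in F q i -> x \in F p i.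
Proof.
move=> pq; have -> : q = p + `|q - p|%N by lia.
elim: `|q - p|%N => [|m IHm]; first by rewrite addr0.
move=> xF; apply/IHm/fil_decr; move: xF.
by have -> : p + m.+1 = p + m + 1 :> int by lia.
Qed.

(* Modulo [bdry W (p - r + 1) (p + 1) n], the elements of [W^p A^n] with
   boundary in [W^(p + r)] form [E_r] of [W]. *)
Definition bdry (U : filtration A) (q p n : int) : submodClosed (A n) :=
  addS (U p n) (imgS (diff A (n - 1) n) (U q (n - 1))).

Lemma bdryP (U : filtration A) (q p m n : int) x : n = m + 1 ->
  x \in bdry U q p n <->
  exists2 y, y \in U q m & x - diff A m n y \in U p n.
Proof.
move=> e; have -> : m = n - 1 by lia.
split=> [/addSP [s [_ [sU /imgSP [y yU <-] ->]]]|[y yU xy]].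
  by exists y; rewrite ?addrK.
apply/addSP; exists (x - diff A (n - 1) n y), (diff A (n - 1) n y).
by rewrite subrK; split=> //; apply/imgSP; exists y.
Qed.

Lemma bdry_fil (U : filtration A) (q p n : int) x :
  x \in U p n -> x \in bdry U q p n.
Proof.
move=> xU; apply/(@bdryP U q p (n - 1)); first by lia.
by exists 0; rewrite ?rpred0 // linear0 subr0.
Qed.

Lemma bdry_diff (U : filtration A) (q p m n : int) x :
  x \in U q m -> diff A m n x \in bdry U q p n.
Proof.
move=> xU; have [e|/eqP ne] := eqVneq n (m + 1); last first.
  by rewrite diff_shape // rpred0.
by apply/(bdryP _ _ _ _ e); exists x; rewrite // subrr rpred0.
Qed.

Lemma bdry_le (U : filtration A) (q q' p p' n : int) x : q <= q' -> p <= p' ->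
  x \in bdry U q' p' n -> x \in bdry U q p n.
Proof.
move=> qq pp /addSP [s [_ [sU /imgSP [y yU <-] ->]]].
by apply: rpredD; [apply/bdry_fil/(fil_le pp) | apply/bdry_diff/(fil_le qq)].
Qed.

(** Quantifying over every target degree avoids transport along equalities of degrees; only
    [j = n + 1] carries information. *)
Definition boundary_in (U : filtration A) (p n : int) (x : A n) : Prop :=
  forall j, diff A n j x \in U p j.

Lemma boundary_in_succ (U : filtration A) (p m n : int) (x : A m) :
  n = m + 1 -> diff A m n x \in U p n -> boundary_in U p x.
Proof.
move=> -> dx j; have [->//|/eqP ne] := eqVneq j (m + 1).
by rewrite diff_shape // rpred0.
Qed.

Lemma boundary_in_le (U : filtration A) (p q n : int) (x : A n) : p <= q ->
  boundary_in U q x -> boundary_in U p x.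
Proof. by move=> pq bx j; apply: fil_le pq (bx j). Qed.

Lemma bdry_of_diff (U : filtration A) (q p p' m n : int) (x : A m) :
  x \in bdry U q p m -> diff A m n x \in bdry U p p' n.
Proof.
move=> /addSP [s [_ [sU /imgSP [y _ <-] ->]]].
by rewrite linearD diff_diff addr0; apply: bdry_diff.
Qed.

Section Cap.
Variables (F W : filtration A) (k : int).

(** The filtration induced by [W] on the subcomplex F^k A, kept as a filtration of [A] so that it
    can be compared with [W] without inclusion maps. *)
Definition cap_obj (p i : int) : submodClosed (A i) := capS (F k i) (W p i).

Fact cap_decr p i x : x \in cap_obj (p + 1) i -> x \in cap_obj p i.
Proof. by move=> /capSP [xF xW]; apply/capSP; split=> //; apply: fil_decr. Qed.

Fact cap_diff p i j x : x \in cap_obj p i -> diff A i j x \in cap_obj p j.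
Proof. by move=> /capSP [xF xW]; apply/capSP; split; apply: fil_diff. Qed.

Definition cap_fil : filtration A := Filtration cap_decr cap_diff.

Lemma cap_filP p i x :
  reflect (x \in F k i /\ x \in W p i) (x \in cap_fil p i).
Proof. exact: capSP. Qed.

End Cap.

(** The axioms are symmetric in the two Hodge filtrations, so each result on [F] also serves for
    [G]. *)
Lemma hodge_complexC (F G W : filtration A) :
  hodge_complex F G W -> hodge_complex G F W.
Proof.
move=> [bA bF bG bW fA sF sG pure]; split=> // i p.
by have [V [/hodge_structureC hV V1 V0]] := pure i p; exists V.
Qed.

End Complexes.

(** * Cycles, boundaries and classes of E_1 = H(Gr_W) on representatives *)

Section FirstPage.
Variables (K : fieldType) (A : cochain_complex K) (W : filtration A).
Variables p n : int.
Local Notation cl := (subquo_class (W p n) (W (p + 1) n)).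
Implicit Types x : submod (W p n).

Lemma gr_diffP m (z : submod (W p m)) x :
  diff (gr W p) m n (subquo_class _ (W (p + 1) m) z) = cl x <->
  incl x - diff A m n (incl z) \in W (p + 1) n.
Proof.
rewrite [diff _ _ _ _]subquo_mapE; split=> [/esym/subquo_classP //|xz].
exact/esym/subquo_classP.
Qed.

Lemma gr_cycleP x :
  cl x \in kerS (diff (gr W p) n (n + 1)) <-> boundary_in W (p + 1) (incl x).
Proof.
split=> [/kerSP dx|bx]; last first.
  by apply/kerSP; rewrite [LHS]subquo_mapE; apply/subquo_class0P/bx.
apply: boundary_in_succ (erefl _) _.
apply/(@subquo_class0P _ _ (W p _) _ (submod_map (@fil_diff _ A W p _ _) x)).
by rewrite -[RHS]dx [RHS]subquo_mapE.
Qed.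

Lemma gr_bdryP x : cl x \in imgS (diff (gr W p) (n - 1) n) (topS _) <->
  incl x \in bdry W p (p + 1) n.
Proof.
have e : n = n - 1 + 1 by lia.
split=> [/imgSP [c _]|/(bdryP _ _ _ _ e) [y yW xy]].
  have [z <-] := subquo_surj c => /gr_diffP xz.
  by apply/(bdryP _ _ _ _ e); exists (incl z) => //; apply: valP.
apply/imgSP; exists (subquo_class _ (W (p + 1) (n - 1)) (to_submod yW)).
  exact: in_topS.
exact/gr_diffP.
Qed.

Lemma gr_coh_filP (F : filtration A) k x
    (bx : cl x \in kerS (diff (gr W p) n (n + 1))) :
  subquo_class _ (imgS (diff (gr W p) (n - 1) n) (topS _)) (to_submod bx)
    \in coh_fil (gr_fil W p F) n k <->
  exists f, [/\ f \in cap_fil F W k p n, boundary_in W (p + 1) f &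
                incl x - f \in bdry W p (p + 1) n].
Proof.
split=> [/coh_filP [_ [/imgSP [f /preimSP fF <-] /kerSP/gr_cycleP bf]]|].
  move=> xf; exists (incl f); split=> //.
    by apply/cap_filP; split=> //; apply: valP.
  by apply/(gr_bdryP (x - f)); rewrite linearB.
move=> [f [/cap_filP [fF fW] bf xf]].
pose f' : submod (W p n) := to_submod fW.
apply/coh_filP; exists (cl f'); split.
- by apply/imgSP; exists f' => //; apply/preimSP.
- exact/kerSP/gr_cycleP.
- by have := (gr_bdryP (x - f')).2 xf; rewrite linearB.
Qed.

Lemma gr_coh_surj (c : coh (gr W p) n) :
  exists x (bx : cl x \in kerS (diff (gr W p) n (n + 1))),
    c = subquo_class _ (imgS (diff (gr W p) (n - 1) n) (topS _)) (to_submod bx).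
Proof.
have [[c' bx] <-] := subquo_surj c; have [x ex] := subquo_surj c'.
by subst c'; exists x, bx.
Qed.

End FirstPage.

(** * Strictness and purity of E_1, from HC2 and HC3 *)

Section SecondPage.
Variables (K : fieldType) (A : cochain_complex K) (F G W : filtration A).
Hypothesis hc : hodge_complex F G W.
Implicit Types (k l p n : int).

(** This is HC2: strictness of [F] on Gr_W^p lets the primitive be chosen in F^k, so the E_1 of F^k
    A injects into that of [A]. *)
Lemma bdry1_cap k p n (x : A n) : x \in cap_fil F W k p n ->
  x \in bdry W p (p + 1) n -> x \in bdry (cap_fil F W k) p (p + 1) n.
Proof.
have [m e] : exists m, n = m + 1 by exists (n - 1); lia.
subst n => /cap_filP [xF xW] /(bdryP _ _ _ _ erefl) [y yW xy].
have /imgSP [c] : subquo_class _ (W (p + 1) (m + 1)) (to_submod xW)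
    \in imgS (diff (gr W p) m (m + 1)) (gr_fil W p F k m).
  rewrite (hc2_F hc); apply/capSP; split; apply/imgSP.
    exists (subquo_class _ _ (to_submod yW)); [exact: in_topS | exact/gr_diffP].
  by exists (to_submod xW) => //; apply/preimSP.
move=> /imgSP [z /preimSP zF <-] /gr_diffP xz.
apply/(bdryP _ _ _ _ erefl); exists (incl z).
  by apply/cap_filP; split=> //; apply: valP.
apply/cap_filP; split=> //.
by apply: submodB => //; apply: fil_diff.
Qed.

Lemma page1_decomp k l p n (x : A n) : k + l = n - p + 1 ->
  x \in W p n -> boundary_in W (p + 1) x ->
  exists f g, [/\ f \in cap_fil F W k p n, boundary_in W (p + 1) f,
    g \in cap_fil G W l p n, boundary_in W (p + 1) g &
    x - f - g \in bdry W p (p + 1) n].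
Proof.
move=> kl xW bx; have [dec _] := pure_direct_sum (hc3 hc n p) kl.
pose x' := to_submod xW; have bx' := (gr_cycleP x').2 bx.
have /addSP [s [t []]] := dec (subquo_class _ _ (to_submod bx')).
have [u [bu ->]] := gr_coh_surj s; have [v [bv ->]] := gr_coh_surj t.
move=> /gr_coh_filP [f [fF bf uf]] /gr_coh_filP [g [gG bg vg]].
rewrite -linearD => /subquo_classP xuv.
exists f, g; split=> //.
have -> : x - f - g = incl (x' - (u + v)) + ((incl u - f) + (incl v - g)).
  have -> : incl (x' - (u + v)) = x - (incl u + incl v) by [].
  by rewrite [incl u - f + _]addrACA [RHS]addrA subrK addrA.
rewrite rpredD ?(rpredD uf) //.
by apply/gr_bdryP; rewrite linearB linearD.
Qed.

(** When k + l exceeds n - p + 1, G^l is contained in the exact complement G^(n-p+1-k), and the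
    directness given by HC3 applies to that pair. *)
Lemma page1_inter k l p n (f g : A n) : n - p + 1 <= k + l ->
  f \in cap_fil F W k p n -> boundary_in W (p + 1) f ->
  g \in cap_fil G W l p n -> boundary_in W (p + 1) g ->
  f - g \in bdry W p (p + 1) n -> f \in bdry W p (p + 1) n.
Proof.
move=> kl fF bf /cap_filP [gG gW] bg fg.
have kl' : k + (n - p + 1 - k) = n - p + 1 by lia.
have [_ int] := pure_direct_sum (hc3 hc n p) kl'.
have /cap_filP [_ fW] := fF.
pose f' := to_submod fW; have bf' := (gr_cycleP f').2 bf.
suff /subquo_class0P : subquo_class _
    (imgS (diff (gr W p) (n - 1) n) (topS _)) (to_submod bf') = 0.
  by move/(gr_bdryP f').
apply: int.
  by apply/gr_coh_filP; exists f; split=> //; rewrite subrr rpred0.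
apply/gr_coh_filP; exists g; split=> //; apply/cap_filP; split=> //.
by apply: fil_le gG; lia.
Qed.

End SecondPage.

(** * Boundaries and cycles of d_1 *)

Section SecondPageHodge.
Variables (K : fieldType) (A : cochain_complex K) (F G W : filtration A).
Implicit Types (k l p n : int).

(* Splitting the primitive [y] in [E_1 = F^k + G^l] splits [d y] with the same
   [k] and [l], because [d_1] preserves the weight; hence [d_1] is strict. *)
Lemma page1_primitive (hc : hodge_complex F G W) k l p n (y : A (n - 1)) :
  k + l = n - p + 1 -> y \in W (p - 1) (n - 1) ->
  diff A (n - 1) n y \in W p n ->
  exists f g, [/\ f \in cap_fil F W k (p - 1) (n - 1),
    diff A (n - 1) n f \in cap_fil F W k p n,
    g \in cap_fil G W l (p - 1) (n - 1),
    diff A (n - 1) n g \in cap_fil G W l p n &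
    diff A (n - 1) n (y - f - g) \in bdry W p (p + 1) n].
Proof.
move=> kl yW dyW; have e : n = n - 1 + 1 by lia.
have by' : boundary_in W (p - 1 + 1) y.
  by apply: boundary_in_succ e _; rewrite subrK.
have kl' : k + l = n - 1 - (p - 1) + 1 by lia.
have [f [g [fF bf gG bg yfg]]] := page1_decomp hc kl' yW by'.
have /cap_filP [fFk _] := fF; have /cap_filP [gGl _] := gG.
rewrite subrK in bf bg yfg.
exists f, g; split=> //; last exact: bdry_of_diff yfg.
  by apply/cap_filP; split; [apply: fil_diff | apply: bf].
by apply/cap_filP; split; [apply: fil_diff | apply: bg].
Qed.

(** Split the primitive y as f + g in E_1 for complementary k and l. There x - df has the class of
    dg, which lies in F^k and in G^l, hence vanishes; [bdry1_cap] then gives x - df a primitive in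
    F^k. *)
Lemma bdry2_cap (hc : hodge_complex F G W) k p n (x : A n) :
  x \in cap_fil F W k p n -> x \in bdry W (p - 1) (p + 1) n ->
  x \in bdry (cap_fil F W k) (p - 1) (p + 1) n.
Proof.
have e : n = n - 1 + 1 by lia.
move=> xF /(bdryP _ _ _ _ e) [y yW xy].
have /cap_filP [_ xW] := xF.
have dyW : diff A (n - 1) n y \in W p n.
  by rewrite -(subKr x (diff A _ _ y)) submodB // fil_decr.
have kl : k + (n - p + 1 - k) = n - p + 1 by lia.
have [f [g [fF dfF gG dgG yfg]]] := page1_primitive hc kl yW dyW.
set df := diff A (n - 1) n f in dfF *; set dg := diff A (n - 1) n g in dgG *.
have xdfF : x - df \in cap_fil F W k p n by apply: submodB.
have bx : boundary_in W (p + 1) (x - df).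
  move=> j; rewrite linearB diff_diff subr0.
  have -> : diff A n j x = diff A n j (x - diff A (n - 1) n y).
    by rewrite linearB diff_diff subr0.
  exact: fil_diff.
have bdg : boundary_in W (p + 1) dg by move=> j; rewrite diff_diff rpred0.
have kl' : n - p + 1 <= k + (n - p + 1 - k) by lia.
have /(bdry1_cap hc xdfF) xdf : x - df \in bdry W p (p + 1) n.
  apply: (page1_inter hc kl' xdfF bx dgG bdg).
  have -> : x - df - dg =
      (x - diff A (n - 1) n y) + diff A (n - 1) n (y - f - g).
    by rewrite !linearB /= -/df -/dg [RHS]addrA addrA subrK.
  by rewrite rpredD // bdry_fil.
rewrite -(subrK df x) rpredD //; last exact: bdry_diff.
by apply: bdry_le xdf; lia.
Qed.

(** If d_1 kills f + g, then df = d(-g) in E_1. This class lies in F^k and G^l, and its weight (n +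
    1) - (p + 1) is still n - p, so it is zero. By [bdry1_cap] its primitive [y] can be taken in
    F^k. *)
Lemma page1_kernel (hc : hodge_complex F G W) k l p n (f g : A n) :
  n - p + 1 <= k + l ->
  f \in cap_fil F W k p n -> boundary_in W (p + 1) f ->
  g \in cap_fil G W l p n -> boundary_in W (p + 1) g ->
  diff A n (n + 1) (f + g) \in bdry W (p + 1) (p + 2) (n + 1) ->
  exists2 y, y \in cap_fil F W k (p + 1) n & boundary_in W (p + 2) (f - y).
Proof.
move=> kl /cap_filP [fF fW] bf /cap_filP [gG gW] bg dfg.
have p2 : p + 2 = p + 1 + 1 by lia.
rewrite p2 in dfg *.
have dfF : diff A n (n + 1) f \in cap_fil F W k (p + 1) (n + 1).
  by apply/cap_filP; split; [apply: fil_diff | apply: bf].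
have : diff A n (n + 1) f \in bdry W (p + 1) (p + 1 + 1) (n + 1).
  apply: (@page1_inter _ _ _ _ _ hc k l (p + 1) (n + 1) _
    (diff A n (n + 1) (- g))) => //; first lia.
  - by move=> j; rewrite diff_diff rpred0.
  - apply/cap_filP; split; first by rewrite fil_diff // submodN.
    by rewrite linearN submodN; apply: bg.
  - by move=> j; rewrite diff_diff rpred0.
  - by rewrite -linearB opprK.
move=> /(bdry1_cap hc dfF) /(bdryP _ _ _ _ erefl) [y yF dfy].
exists y => //; apply: boundary_in_succ (erefl _) _.
by rewrite linearB; have /cap_filP [] := dfy.
Qed.

End SecondPageHodge.

(** * Opposedness on E_2 and vanishing of the higher differentials *)

Section Degeneration.
Variables (K : fieldType) (A : cochain_complex K) (F G W : filtration A).
Hypothesis hc : hodge_complex F G W.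
Implicit Types (k l p n : int).

(** Both components of the E_1 splitting are cycles for d_1 by [page1_kernel], applied once to [F]
    and once, by symmetry, to [G]. *)
Lemma page2_decomp k l p n (x : A n) : k + l = n - p + 1 ->
  x \in W p n -> boundary_in W (p + 2) x ->
  exists f g, [/\ f \in cap_fil F W k p n, boundary_in W (p + 2) f,
    g \in cap_fil G W l p n, boundary_in W (p + 2) g &
    x - f - g \in bdry W (p - 1) (p + 1) n].
Proof.
move=> kl xW bx.
have bx1 : boundary_in W (p + 1) x by apply: boundary_in_le bx; lia.
have [f [g [fF bf gG bg xfg]]] := page1_decomp hc kl xW bx1.
have dfg : diff A n (n + 1) (f + g) \in bdry W (p + 1) (p + 2) (n + 1).
  have -> : f + g = x - (x - f - g) by rewrite -addrA -opprD subKr.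
  rewrite linearB submodB //; first by apply/bdry_fil/bx.
  exact: bdry_of_diff xfg.
have klp : n - p + 1 <= k + l by lia.
have lkp : n - p + 1 <= l + k by lia.
have [y yF fy] := page1_kernel hc klp fF bf gG bg dfg.
rewrite (addrC f) in dfg.
have [z zG gz] := page1_kernel (hodge_complexC hc) lkp gG bg fF bf dfg.
exists (f - y), (g - z); split=> //.
- exact/submodB/fil_decr.
- exact/submodB/fil_decr.
rewrite subrBB rpredD //; first by apply: bdry_le xfg; lia.
have [/cap_filP [_ yW] /cap_filP [_ zW]] := (yF, zG).
by apply/bdry_fil/rpredD.
Qed.

(** Splitting the primitive of f - g as u + v makes f - du and g + dv equal in E_1, where they lie
    in complementary steps; so f - du dies in E_1 and f in E_2. *)
Lemma page2_inter k l p n (f g : A n) : n - p + 1 <= k + l ->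
  f \in cap_fil F W k p n -> boundary_in W (p + 1) f ->
  g \in cap_fil G W l p n -> boundary_in W (p + 1) g ->
  f - g \in bdry W (p - 1) (p + 1) n -> f \in bdry W (p - 1) (p + 1) n.
Proof.
move=> kl; have e : n = n - 1 + 1 by lia.
have kl' : k + (n - p + 1 - k) = n - p + 1 by lia.
have kl2 : n - p + 1 <= k + (n - p + 1 - k) by lia.
have lkl : n - p + 1 - k <= l by lia.
have pp : p - 1 <= p by lia.
move=> fF bf gG bg /(bdryP _ _ _ _ e) [y yW xy].
have [/cap_filP [_ fW] /cap_filP [gGl gW]] := (fF, gG).
have dyW : diff A (n - 1) n y \in W p n.
  rewrite -(subKr (f - g) (diff A _ _ y)).
  exact: submodB (submodB fW gW) (fil_decr xy).
have [u [v [uF duF vG dvG yuv]]] := page1_primitive hc kl' yW dyW.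
set du := diff A (n - 1) n u in duF *; set dv := diff A (n - 1) n v in dvG *.
suff : f - du \in bdry W p (p + 1) n.
  move=> fdu; rewrite -(subrK du f) rpredD //; first exact: bdry_le fdu.
  by apply: bdry_diff; have /cap_filP [] := uF.
have gF : g \in cap_fil G W (n - p + 1 - k) p n.
  by apply/cap_filP; split=> //; apply: fil_le gGl.
apply: (page1_inter hc kl2 (submodB fF duF) _ (rpredD gF dvG)).
- by move=> j; rewrite linearB diff_diff subr0.
- by move=> j; rewrite linearD diff_diff addr0.
have -> : f - du - (g + dv) =
    (f - g - diff A (n - 1) n y) + diff A (n - 1) n (y - u - v).
  rewrite !linearB /= -/du -/dv [RHS]addrA addrA subrK.
  by rewrite opprD addrA [f - du - g]addrAC.
by rewrite rpredD // bdry_fil.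
Qed.

(* For [r >= 0] and [U = W] this is the vanishing of [d_r] of [W]; with
   [U = cap_fil F W k] it is the vanishing of [d_r] on the filtered subcomplex
   [F^k A]. *)
Definition vanishing (U : filtration A) (r : int) : Prop :=
  forall p n (x : A n), x \in U p n -> boundary_in W (p + r) x ->
  exists2 y, y \in U (p + 1) n & boundary_in W (p + r + 1) (x - y).

(** Each vanishing differential pushes the boundary one step deeper into [W], and the successive
    corrections add up inside U^(p+1). *)
Lemma vanishing_improve (U : filtration A) (t : nat) p n (x : A n) :
  (forall s : nat, (s < t)%N -> vanishing U (2 + s)) ->
  x \in U p n -> boundary_in W (p + 2) x ->
  exists2 y, y \in U (p + 1) n & boundary_in W (p + 2 + t) (x - y).
Proof.
elim: t => [|t IHt] van xU bx.
  by exists 0; rewrite ?rpred0 // ?subr0.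
have [s st|y yU bxy] := IHt _ xU bx; first exact/van/ltnW.
have xyU : x - y \in U p n by apply/submodB/fil_decr.
rewrite -addrA in bxy.
have [z zU bz] := van t (ltnSn t) _ _ _ xyU bxy.
exists (y + z); rewrite ?rpredD //.
by rewrite opprD [X in boundary_in _ _ X]addrA; apply: boundary_in_le bz; lia.
Qed.

(** If d_2, ..., d_(t+1) vanish, nothing beyond the image of d_1 is divided out on the next
    pages. *)
Lemma vanishing_bdry (t : nat) p n (x : A n) :
  (forall s : nat, (s < t)%N -> vanishing W (2 + s)) ->
  x \in W p n -> x \in bdry W (p - 1 - t%:Z) (p + 1) n ->
  x \in bdry W (p - 1) (p + 1) n.
Proof.
have e : n = n - 1 + 1 by lia.
elim: t => [|t IHt] van xW; first by rewrite subr0.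
move=> /(bdryP _ _ _ _ e) [y yW xy].
have by' : boundary_in W (p - 1 - t.+1%:Z + (2 + t)) y.
  have -> : p - 1 - t.+1%:Z + (2 + t) = p by lia.
  apply: boundary_in_succ e _.
  by rewrite -(subKr x (diff A _ _ y)) submodB // fil_decr.
(* The boundary of [y] lies 2 + t steps after [y], so the vanishing of d_(2+t) trades [y] for [z]
   one step deeper in [W], changing dy only inside W^(p+1). *)
have [z zW byz] := van t (ltnSn t) _ _ _ yW by'.
apply: IHt => [s st||]; [exact/van/ltnW | by [] |].
apply/(bdryP _ _ _ _ e); exists z; first by apply: fil_le zW; lia.
have -> : x - diff A (n - 1) n z
    = (x - diff A (n - 1) n y) + diff A (n - 1) n (y - z).
  by rewrite linearB addrA subrK.
by rewrite rpredD //; apply: fil_le (byz n); lia.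
Qed.

(** Vanishing on [A] makes dx a boundary modulo the next step of [W]; [vanishing_bdry] brings the
    primitive down to d_1 range, and [bdry2_cap] moves it into F^k. *)
Lemma vanishing_cap k (t : nat) :
  (forall s : nat, (s <= t)%N -> vanishing W (2 + s)) ->
  vanishing (cap_fil F W k) (2 + t).
Proof.
move=> van p n x xF bx; have /cap_filP [xFk xW] := xF.
have [y yW bxy] := van t (leqnn t) _ _ _ xW bx.
have dxF : diff A n (n + 1) x \in cap_fil F W k (p + (2 + t)) (n + 1).
  by apply/cap_filP; split; [apply: fil_diff | apply: bx].
have /(bdry2_cap hc dxF)/(bdryP _ _ _ _ erefl) [z zF dxz] :
    diff A n (n + 1) x
      \in bdry W (p + (2 + t) - 1) (p + (2 + t) + 1) (n + 1).
  apply: (@vanishing_bdry t) => [s st||]; [exact/van/ltnW | exact: bx |].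
  apply/(bdryP _ _ _ _ erefl); exists y; first by apply: fil_le yW; lia.
  by rewrite -linearB; apply: bxy.
exists z; first by apply: fil_le zF; lia.
apply: boundary_in_succ (erefl _) _.
by rewrite linearB; have /cap_filP [] := dxz.
Qed.

(** The downward induction on k: the F^(k+1) part is left to the induction, and the rest is killed
    by the drop of weight under d_r with r >= 2. *)
Lemma vanishing_step (t : nat) :
  (forall s : nat, (s < t)%N -> vanishing W (2 + s)) ->
  (forall s : nat, (s < t)%N -> forall k, vanishing (cap_fil F W k) (2 + s)) ->
  (forall s : nat, (s < t)%N -> forall l, vanishing (cap_fil G W l) (2 + s)) ->
  vanishing W (2 + t).
Proof.
move=> vanW vanF vanG p n.
have [r er] : exists r, r = p + (2 + t) by exists (p + (2 + t)).
have rt : r - 1 - t%:Z = p + 1 by lia.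
have pr2 : p + 2 <= r by lia.
have pr1 : p + 1 <= r - 1 by lia.
rewrite -er.
(* [N] bounds the number of steps of [F] left before it becomes zero in degree [n]; at the start k =
   a, where F^a is everything. *)
suff claim (N : nat) k x : (forall z, z \in F (k + N) n -> z = 0) ->
    x \in F k n -> x \in W p n -> boundary_in W r x ->
    exists2 y, y \in W (p + 1) n & boundary_in W (r + 1) (x - y).
  move=> x; have [a [b [aF bF]]] := hc_F_biregular hc n.
  apply: (claim `|b - a|%N a) => [z zF|]; last exact: aF.
  by apply: bF; apply: fil_le zF; lia.
elim: N k x => [|N IHN] k x FN xF xW bx.
  exists 0; rewrite ?rpred0 // subr0 [x]FN => [j|].
    by rewrite linear0 rpred0.
  by apply: fil_le xF; lia.
have kN : k + N.+1 = k + 1 + N by lia.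
(* The indices k + 1 and n - p - k are complementary for the weight n - p of the source. The pair k,
   n - p - k still has trivial intersection in the target, whose weight n + 1 - r is smaller because
   r >= p + 2. *)
have wt : n + 1 - r + 1 <= k + (n - p - k) by lia.
have e : n = n - 1 + 1 by lia.
have kl : (k + 1) + (n - p - k) = n - p + 1 by lia.
have bx2 : boundary_in W (p + 2) x by apply: boundary_in_le bx.
have [f [g [fF bf gG bg xfg]]] := page2_decomp kl xW bx2.
(* The differentials before d_(2+t) vanish on F^(k+1) A and G^l A, so [f] and [g] can be corrected
   there until their boundaries reach W^r. *)
have [u uF bfu] := vanishing_improve (fun s st => vanF s st _) fF bf.
have [v vG bgv] := vanishing_improve (fun s st => vanG s st _) gG bg.
have fuF : f - u \in cap_fil F W (k + 1) p n by apply/submodB/fil_decr.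
have gvG : g - v \in cap_fil G W (n - p - k) p n by apply/submodB/fil_decr.
have /cap_filP [fuFk fuW] := fuF; have /cap_filP [gvGl _] := gvG.
rewrite -addrA -er in bfu bgv.
have FN' z : z \in F (k + 1 + N) n -> z = 0.
  by rewrite -kN; apply: FN.
have [y yW bfuy] := IHN (k + 1) (f - u) FN' fuFk fuW bfu.
have /(bdryP _ _ _ _ e) [z zW xfgz] := xfg.
(* Here x - (f - u) lies in F^k and agrees with g - v modulo W^(p+1) and a boundary, so its
   differential is in both F^k and G^(n-p-k) of the target. *)
have : diff A n (n + 1) (x - (f - u)) \in bdry W (r - 1) (r + 1) (n + 1).
  apply: (@page2_inter k (n - p - k) r _ _ (diff A n (n + 1) (g - v))).
  - exact: wt.
  - apply/cap_filP; split.
    by apply/fil_diff/submodB => //; apply: fil_decr.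
    by rewrite linearB; apply: submodB; [apply: bx | apply: bfu].
  - by move=> j; rewrite diff_diff rpred0.
  - by apply/cap_filP; split; [apply: fil_diff | apply: bgv].
  - by move=> j; rewrite diff_diff rpred0.
  apply: (@vanishing_bdry t) => //.
    rewrite linearB; apply: submodB.
      by apply: submodB; [apply: bx | apply: bfu].
    exact: bgv.
  rewrite -linearB.
  set w := x - (f - u) - (g - v).
  have -> : diff A n (n + 1) w = diff A n (n + 1) (w - diff A (n - 1) n z).
    by rewrite [RHS]linearB diff_diff subr0.
  rewrite rt; apply: bdry_diff.
  rewrite /w subrBB addrAC.
  have [/cap_filP [_ uW] /cap_filP [_ vW]] := (uF, vG).
  by rewrite rpredD // rpredD.
move=> /(bdryP _ _ _ _ erefl) [y' y'W bxy].
exists (y + y').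
  by rewrite rpredD //; apply: fil_le y'W.
apply: boundary_in_succ (erefl _) _.
have -> : x - (y + y') = (x - (f - u) - y') + (f - u - y).
  by rewrite [x - _ - y']addrAC addrA subrK opprD addrA addrAC.
by rewrite linearD rpredD // linearB.
Qed.

End Degeneration.

(** * Consequences of degeneration: permanent cycles and strictness for [F] *)

Section Main.
Variables (K : fieldType) (A : cochain_complex K) (F G W : filtration A).
Hypothesis hc : hodge_complex F G W.
Implicit Types (k l p n : int).

Lemma vanishing_weight (t : nat) : vanishing W W (2 + t).
Proof.
elim/ltn_ind: t => t IHt; apply: (vanishing_step hc) => // s st k.
  by apply: (vanishing_cap hc) => r rs; apply/IHt/(leq_ltn_trans rs).
apply: (vanishing_cap (hodge_complexC hc)) => r rs.
exact/IHt/(leq_ltn_trans rs).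
Qed.

(** Biregularity gives W^b = 0 in degree n + 1; after enough corrections the boundary lies in
    W^b. *)
Lemma permanent_cycle k p n (f : A n) : f \in cap_fil F W k p n ->
  boundary_in W (p + 2) f ->
  exists2 y, y \in cap_fil F W k (p + 1) n & forall j, diff A n j (f - y) = 0.
Proof.
move=> fF bf; have [_ [b [_ bW]]] := hc_W_biregular hc (n + 1).
have [N bt] : exists N : nat, b <= p + 2 + N.
  by exists (absz (b - p - 2)%R); lia.
have van (s : nat) : (s < N)%N -> vanishing W (cap_fil F W k) (2 + s).
  by move=> _; apply: (vanishing_cap hc) => r _; apply: vanishing_weight.
have [y yF bfy] := vanishing_improve van fF bf.
exists y => // j; have [->|/eqP ne] := eqVneq j (n + 1); last exact: diff_shape.
exact/bW/(fil_le bt)/bfy.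
Qed.

(** Since every d_r with r >= 2 vanishes, a primitive of arbitrary depth can be replaced by one in
    W^(p-1). *)
Lemma bdry_weight q p n (x : A n) : x \in W p n ->
  x \in bdry W q (p + 1) n -> x \in bdry W (p - 1) (p + 1) n.
Proof.
move=> xW xq; have [t qt] : exists t : nat, p - 1 - t%:Z <= q.
  by exists (absz (p - 1 - q)%R); lia.
apply: (@vanishing_bdry _ _ W t) => // [s _|].
  exact: vanishing_weight.
exact: bdry_le xq.
Qed.

(* A class of [F^k H] lying in [W^p H] has a representative in [F^k] and
   [W^p] simultaneously. *)
Lemma fil_bdry_weight k p m n (x : A n) (y : A m) : n = m + 1 ->
  x \in F k n -> x - diff A m n y \in W p n ->
  exists2 z, z \in F k m & x - diff A m n z \in W p n.
Proof.
move=> e; have em : m = n - 1 by lia.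
subst m; have [a [_ [aW _]]] := hc_W_biregular hc n.
(* W^a is all of A^n, so [x] is finitely many steps short of W^p; the induction gains one step at a
   time. *)
have : x \in W (p - `|p - a|%N%:Z) n.
  by apply: fil_le (aW x); lia.
elim: `|p - a|%N x y => [|N IHN] x y xW xF xy.
  by exists 0; rewrite ?rpred0 // linear0 subr0; apply: fil_le xW; lia.
have eN : p - N.+1%:Z + 1 = p - N%:Z by lia.
have pN : p - N.+1%:Z + 1 <= p by lia.
have [q [_ [qW _]]] := hc_W_biregular hc (n - 1).
have xq : x \in bdry W q (p - N.+1%:Z + 1) n.
  apply/(bdryP _ _ _ _ e); exists y; first exact: qW.
  exact: fil_le pN xy.
have xFW : x \in cap_fil F W k (p - N.+1%:Z) n by apply/cap_filP.
(* Degeneration first brings the uncontrolled primitive [y] to the level of d_1, then strictness of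
   d_1 moves it into F^k. The induction continues with x - dz and its primitive y - z. *)
have /(bdryP _ _ _ _ e) [z /cap_filP [zF _]] :=
  bdry2_cap hc xFW (bdry_weight xW xq).
rewrite eN => /cap_filP [xzF xzW].
have [|z' z'F xz'] := IHN _ (y - z) xzW xzF.
  by rewrite linearB opprB addrA subrK.
exists (z + z'); first exact: rpredD.
by rewrite linearD opprD addrA.
Qed.

(** The case x = dy of [fil_bdry_weight], with p = b so deep that W^b = 0. *)
Lemma fil_strict k m n (y : A m) : n = m + 1 -> diff A m n y \in F k n ->
  exists2 z, z \in F k m & diff A m n y = diff A m n z.
Proof.
move=> e dyF; have [_ [b [_ bW]]] := hc_W_biregular hc n.
have [|z zF /bW/eqP] := @fil_bdry_weight k b m n _ y e dyF.
  by rewrite subrr rpred0.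
by rewrite subr_eq0 => /eqP; exists z.
Qed.

End Main.

(** * From representatives back to the terms E_r and to the filtrations on cohomology *)

Section SpectralSequence.
Variables (K : fieldType) (A : cochain_complex K).

(** Write dx = d(x - y) + dy: the first summand lies one step deeper in [F], and the second is the
    boundary of an element of Z_(r-1)^(p+1). These are the two parts of [ss_B]. *)
Lemma ss_Z_vanishing (F : filtration A) (r p n m : int) (x : A n) :
  vanishing F F r -> m = n + 1 -> x \in ss_Z F r p n ->
  diff A n m x \in ss_B F r (p + r) m.
Proof.
move=> van em /capSP [xF /preimSP dxF].
have [y yF bxy] := van _ _ _ xF (boundary_in_succ (erefl _) dxF).
have e2 : p + r - r + 1 = p + 1 by lia.
have e3 : p + 1 + (r - 1) = p + r by lia.
have e4 : p + r <= p + r + 1 by lia.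
have e5 : m - 1 = n by lia.
apply/addSP; exists (diff A n m (x - y)), (diff A n m y); split.
- apply/capSP; split; first exact: bxy.
  by apply/preimSP; rewrite diff_diff rpred0.
- apply/imgSP; rewrite e2.
  suff H k : k = n -> exists2 u : A k, u \in ss_Z F (r - 1) (p + 1) k &
      diff A k m u = diff A n m y by apply: H.
  move=> ->; exists y => //; apply/capSP; split=> //; apply/preimSP.
  rewrite e3 -(subKr x y) linearB submodB //.
  exact: fil_le e4 (bxy _).
- by rewrite -linearD subrK.
Qed.

Lemma ss_d_eq0 (F : filtration A) (r p q : int) (x : ss_E F r p q) :
  vanishing F F r -> ss_d F r p q x = 0.
Proof.
move=> van; have [y <-] := subquo_surj x.
rewrite [LHS]subquo_mapE; apply/subquo_class0P/ss_Z_vanishing => //.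
  by lia.
exact: valP.
Qed.

Lemma coh_fil_le (F : filtration A) (i p q : int) (x : coh A i) : p <= q ->
  x \in coh_fil F i q -> x \in coh_fil F i p.
Proof.
move=> pq; have [y <-] := subquo_surj x => /coh_filP [z [zF dz yz]].
by apply/coh_filP; exists z; split=> //; apply: fil_le zF.
Qed.

Lemma coh_fil_finite (F : filtration A) (i c : int) : biregular F ->
  finite_filtration (fun p => coh_fil F i (p + c)).
Proof.
move=> /(_ i) [a [b [aF bF]]]; split.
- by move=> p x; apply: coh_fil_le; lia.
- exists (a - c) => x; have [y <-] := subquo_surj x; apply/coh_filP.
  exists (incl y); split; last by rewrite subrr rpred0.
    by rewrite subrK; apply: aF.
  by have /kerSP := valP y.
- exists (b - c) => x; have [y <-] := subquo_surj x => /coh_filP.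
  rewrite subrK => -[z [/bF -> _]].
  by rewrite subr0 => /subquo_class0P.
Qed.

End SpectralSequence.

(** * Degeneration statements and the Hodge structure on cohomology *)

Section Conclusion.
Variables (K : fieldType) (A : cochain_complex K).
Implicit Types (F G W : filtration A).

Lemma degenerates_weight F G W : hodge_complex F G W -> degenerates_at W 2.
Proof.
move=> hc s s2 p q x; apply: ss_d_eq0.
have -> : s%:Z = 2 + (s - 2)%N by lia.
exact: (vanishing_weight hc).
Qed.

(** By strictness dx = dy with [y] in F^(p+s), which lies in F^(p+1) as s >= 1; then x - y is a
    cycle. *)
Lemma degenerates_hodge F G W : hodge_complex F G W -> degenerates_at F 1.
Proof.
move=> hc s s1 p q x; apply: ss_d_eq0 => {x}p n x xF bx.
have ps : p + 1 <= p + s%:Z by lia.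
have [y yF dxy] := fil_strict hc (erefl _) (bx (n + 1)).
exists y; first exact: fil_le yF.
by apply: boundary_in_succ (erefl _) _; rewrite linearB dxy subrr rpred0.
Qed.

(** A cycle is split in E_2, and [permanent_cycle] turns both components into true cycles without
    leaving F^k or G^l. *)
Lemma coh_weight_decomp F G W i k l p : hodge_complex F G W ->
  k + l = i - p + 1 -> forall c, c \in coh_fil W i p -> exists s t,
    [/\ s \in coh_fil W i p /\ s \in coh_fil F i k,
        t \in coh_fil W i p /\ t \in coh_fil G i l &
        c - s - t \in coh_fil W i (p + 1)].
Proof.
move=> hc kl c; have e : i = i - 1 + 1 by lia.
have [x <-] := subquo_surj c => /coh_filP [z [zW dz xz]].
have bz : boundary_in W (p + 2) z.
  by apply: boundary_in_succ (erefl _) _; rewrite dz rpred0.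
have [f0 [g0 [f0F bf gG0 bg zfg]]] := page2_decomp hc kl zW bz.
have [u uF df] := permanent_cycle hc f0F bf.
have [v vG dg] := permanent_cycle (hodge_complexC hc) gG0 bg.
set f := f0 - u in df; set g := g0 - v in dg.
have /cap_filP [fF fW] : f \in cap_fil F W k p i by apply/submodB/fil_decr.
have /cap_filP [gG gW] : g \in cap_fil G W l p i by apply/submodB/fil_decr.
have {}zfg : z - f - g \in bdry W (p - 1) (p + 1) i.
  have [/cap_filP [_ uW] /cap_filP [_ vW]] := (uF, vG).
  by rewrite /f /g subrBB rpredD //; apply/bdry_fil/rpredD.
clearbody f g; have /(bdryP _ _ _ _ e) [y _ zfgy] := zfg.
have fK : f \in kerS (diff A i (i + 1)) by apply/kerSP.
have gK : g \in kerS (diff A i (i + 1)) by apply/kerSP.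
have exact0 h : h - h \in imgS (diff A (i - 1) i) (topS _).
  by rewrite subrr rpred0.
exists (subquo_class _ _ (to_submod fK)), (subquo_class _ _ (to_submod gK)).
split; first by split; apply/coh_filP; exists f.
  by split; apply/coh_filP; exists g.
rewrite -!linearB; apply/coh_filP.
exists (z - f - g - diff A (i - 1) i y); split=> //.
  by rewrite !linearB /= dz df dg diff_diff !subr0.
have -> : incl (x - to_submod fK - to_submod gK) = incl x - f - g by [].
rewrite subrBBK rpredD //; apply/imgSP; exists y => //; exact: in_topS.
Qed.

(** Once each class has a representative in W^p and in its Hodge step at once, directness on E_2
    shows that the first is a boundary modulo W^(p+1). *)
Lemma coh_weight_inter F G W i k l p : hodge_complex F G W ->
  k + l = i - p + 1 -> forall s t : coh A i,
    s \in coh_fil W i p /\ s \in coh_fil F i k ->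
    t \in coh_fil W i p /\ t \in coh_fil G i l ->
    s - t \in coh_fil W i (p + 1) -> s \in coh_fil W i (p + 1).
Proof.
move=> hc kl.
have e : i = i - 1 + 1 by lia.
have kl' : i - p + 1 <= k + l by rewrite kl.
have [q [_ [qW _]]] := hc_W_biregular hc (i - 1).
pose ex := imgS (diff A (i - 1) i) (topS _).
have exd y : diff A (i - 1) i y \in ex.
  by apply/imgSP; exists y; first exact: in_topS.
(* The two memberships give a priori different representatives, differing by a boundary;
   [fil_bdry_weight] merges them. Stating it for any [T] covers both [F] and [G]. *)
have rep (T : filtration A) m (hT : exists T', hodge_complex T T' W)
    (x : submod (kerS (diff A i (i + 1)))) :
    subquo_class _ ex x \in coh_fil W i p ->
    subquo_class _ ex x \in coh_fil T i m ->
  exists f, [/\ f \in cap_fil T W m p i, diff A i (i + 1) f = 0 &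
                incl x - f \in ex].
  have [T' hT'] := hT.
  move=> /coh_filP [z [zW dz xz]] /coh_filP [f [fT df xf]].
  have /imgSP [y _ fz] : f - z \in ex.
    have -> : f - z = (incl x - z) - (incl x - f).
      by rewrite opprB [RHS]addrC addrA subrK.
    exact: submodB.
  have [|u uT fu] := @fil_bdry_weight _ _ _ _ _ hT' m p _ _ f y e fT.
    by rewrite fz subKr.
  exists (f - diff A (i - 1) i u); split.
  - by apply/cap_filP; split=> //; apply/submodB/fil_diff.
  - by rewrite linearB df diff_diff subr0.
  - by rewrite opprB addrCA addrC rpredD.
move=> s t; have [x <-] := subquo_surj s; have [x' <-] := subquo_surj t.
move=> [xW xF] [x'W x'G].
have [f [fF df xf]] := rep F k (ex_intro _ G hc) x xW xF.
have [g [gG dg xg]] := rep G l (ex_intro _ F (hodge_complexC hc)) x' x'W x'G.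
rewrite -linearB => /coh_filP [w [wW dw xxw]].
have /imgSP [y _ fgy] : f - g - w \in ex.
  rewrite (subrBBB (incl x) (incl x')) rpredD //; exact: submodB.
have /cap_filP [_ fW] := fF; have /cap_filP [_ gW] := gG.
have bf : boundary_in W (p + 1) f.
  by apply: boundary_in_succ (erefl _) _; rewrite df rpred0.
have bg : boundary_in W (p + 1) g.
  by apply: boundary_in_succ (erefl _) _; rewrite dg rpred0.
have /(page2_inter hc kl' fF bf gG bg)/(bdryP _ _ _ _ e) [z _ fz] :
    f - g \in bdry W (p - 1) (p + 1) i.
  apply: (bdry_weight hc (q := q) (submodB fW gW)).
  by apply/(bdryP _ _ _ _ e); exists y => //; rewrite fgy subKr.
apply/coh_filP; exists (f - diff A (i - 1) i z); split=> //.
  by rewrite linearB df diff_diff subr0.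
by rewrite opprB addrCA addrC rpredD.
Qed.

Lemma coh_hodge_structure F G W i : hodge_complex F G W ->
  hodge_structure (coh_fil F i) (coh_fil G i)
    (fun n : int => coh_weight_fil W i (- n)).
Proof.
move=> hc.
have coh0 (T : filtration A) : biregular T -> finite_filtration (coh_fil T i).
  move=> /(coh_fil_finite i 0) [T1 [a Ta] [b Tb]].
  split; first by move=> p x; move: (T1 p x); rewrite !addr0.
    by exists a => x; have := Ta x; rewrite addr0.
  by exists b => x; have := Tb x; rewrite addr0.
split.
- exact: hc1 hc i.
- exact/coh0/(hc_F_biregular hc).
- exact/coh0/(hc_G_biregular hc).
- have [W1 [a Wa] [b Wb]] := coh_fil_finite i i (hc_W_biregular hc).
  split.
  + by move=> p x; rewrite /coh_weight_fil !opprK; apply: W1.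
  + by exists a => x; rewrite /coh_weight_fil opprK; apply: Wa.
  + by exists b => x; rewrite /coh_weight_fil opprK; apply: Wb.
- move=> n k l kl; rewrite /coh_weight_fil.
  (* With p = i - n, lowering the increasing index [n] by one raises the decreasing index p by one,
     and n = i - p is the weight of E_2 at p. *)
  have -> : - (n - 1) + i = - n + i + 1 by lia.
  have {}kl : k + l = i - (- n + i) + 1 by lia.
  apply/direct_sum_indSP.
  by split; [exact: coh_weight_decomp hc kl | exact: coh_weight_inter hc kl].
Qed.

End Conclusion.

Theorem theorem2p11 (R : realType) (A : cochain_complex R[i])
    (F G W : filtration A) :
  hodge_complex F G W ->
  [/\ degenerates_at W 2,
      forall i : int,
        hodge_structure (coh_fil F i) (coh_fil G i)
          (fun n : int => coh_weight_fil W i (- n)),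
      degenerates_at F 1
    & degenerates_at G 1].
Proof.
move=> hc; split=> [|i||].
- exact: degenerates_weight hc.
- exact: coh_hodge_structure.
- exact: degenerates_hodge hc.
- exact: degenerates_hodge (hodge_complexC hc).
Qed.
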